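(* Let $d,d'\ge1$ and let $f:\mathrm{dom}\,X\to\mathrm{dom}\,X'$ be a continuous map satisfying the scaling condition such that the induced map $F:\mathbb{R}^d\to\mathbb{R}^{d'}$ is inversely convexity preserving. Let $\mathcal{S}$ be a trajectory set (with $d+1$ assets), $\mathbf{S}\in\mathcal{S}$ and $k\ge0$. If $(\mathbf{S},k)$ is a $0$-neutral node, then the transformed node $(\mathbf{S}',k)$, where $S'_i=f(S_i)$ for $i\ge 0$, is $0$-neutral, i.e. $$X'(f(S_k))\in\mathrm{cl}\Big(\mathrm{co}\big(\{X'(f(\hat S_{k+1})):\hat{\mathbf{S}}\in\mathcal{S}_{(\mathbf{S},k)}\}\big)\Big),$$ and so $f$ is a $0$-neutral symmetry.
   Context: Coordinates of $s\in\mathbb{R}^{d+1}$ are $s=(s^0,\dots,s^d)$. The perspective function is $X(s)=(s^1/s^0,\dots,s^d/s^0)$ on $\mathrm{dom}\,X=\{s\in\mathbb{R}^{d+1}:s^0>0\}$; $X'$ is the analogous function on $\mathrm{dom}\,X'=\{s\in\mathbb{R}^{d'+1}:s^0>0\}$ with values in $\mathbb{R}^{d'}$. Scaling condition: for every $s\in\mathrm{dom}\,X$ and $\lambda>0$ there is $\mu_{\lambda,s}>0$ with $f(\lambda s)=\mu_{\lambda,s}f(s)$. Under it there is a unique $F:\mathbb{R}^d\to\mathbb{R}^{d'}$ with $F(X(s))=X'(f(s))$ for all $s\in\mathrm{dom}\,X$, called the map induced by $f$. With $[x,y]=\{tx+(1-t)y:0\le t\le1\}$, a map $g:C\to\mathbb{R}^{d'}$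 on a convex set $C\subseteq\mathbb{R}^d$ is inversely convexity preserving if $g([x,y])\subseteq[g(x),g(y)]$ for all $x,y\in C$. Trajectory set: given subsets $\Sigma_i\subseteq\mathbb{R}^{d+1}$, sets $\Omega_i$ ($i\ge0$), $\Theta\subseteq\mathbb{N}$, $s_0\in\mathbb{R}^{d+1}$, $w_0\in\Omega_0$, a trajectory set $\mathcal{S}$ is a set of sequences $\mathbf{S}=\{\mathbf{S}_i=(S_i,W_i,m)\}_{i\ge0}$ with $S_i\in\Sigma_i$, $W_i\in\Omega_i$, $m\in\Theta$, $(S_0,W_0)=(s_0,w_0)$; it is assumed throughout that $S^0_i>0$ for all $i$. Put $M(\mathbf{S})=m$. A node is a pair $(\mathbf{S},k)$, and $\mathcal{S}_{(\mathbf{S},k)}=\{\mathbf{S}'\in\mathcal{S}:\mathbf{S}'_i=\mathbf{S}_i,\ 0\le i\le k,\ M(\mathbf{S}')>k\}$. The node $(\mathbf{S},k)$ is $0$-neutral if $0\in\mathrm{cl}(\mathrm{co}(\{X(\hat S_{k+1})-X(S_k):\hat{\mathbf{S}}\in\mathcal{S}_{(\mathbf{S},k)}\}))$ ($\mathrm{co}$ convex hull, $\mathrm{cl}$ closure). A $0$-neutral symmetry is a map $f$ carrying $0$-neutral nodes to $0$-neutral nodes in the sense of the display in the claim (the components $W,m$ play no role). *)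

(* Defs.v *)
From HB Require Import structures.
From mathcomp Require Export all_boot all_order all_algebra.
From mathcomp Require Export mathcomp_extra boolp classical_sets reals topology.
From mathcomp Require Export normedtype convex.

Set Implicit Arguments.
Unset Strict Implicit.
Unset Printing Implicit Defensive.

Import Order.TTheory GRing.Theory Num.Theory.
Import numFieldNormedType.Exports.

Local Open Scope classical_set_scope.
Local Open Scope ring_scope.

Section Convexity.
Context {R : realType}.

Definition hull_segment (V : lmodType R) (x y : V) : set V :=
  [set t *: x + (1 - t) *: y | t in [set t : R | 0 <= t <= 1]].

Definition convex_hull (V : lmodType R) (A : set V) : set V :=
  smallest (@convex_set R V) A.

(* Meant for convex [C]; values of [g] outside [C] are then irrelevant. *)
Definition inversely_convexity_preserving (V V' : lmodType R) (C : set V)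
    (g : V -> V') : Prop :=
  forall x y, C x -> C y -> g @` hull_segment x y `<=` hull_segment (g x) (g y).

End Convexity.

Section Perspective.
Context {R : realType}.

Definition dom_persp {d : nat} : set 'rV[R]_d.+1 := [set s | 0 < s 0 ord0].

Definition persp {d : nat} (s : 'rV[R]_d.+1) : 'rV[R]_d :=
  \row_(i < d) (s 0 (lift ord0 i) / s 0 ord0).

(* A map [dom_persp -> dom_persp] is represented by a total function, of which
   only the values on [dom_persp] are ever used. *)
Definition scaling_condition {d d' : nat} (f : 'rV[R]_d.+1 -> 'rV[R]_d'.+1)
    : Prop :=
  forall s, dom_persp s -> forall lambda : R, 0 < lambda ->
  exists2 mu : R, 0 < mu & f (lambda *: s) = mu *: f s.

Definition induced_map {d d' : nat} (f : 'rV[R]_d.+1 -> 'rV[R]_d'.+1)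
    (F : 'rV[R]_d -> 'rV[R]_d') : Prop :=
  forall s, dom_persp s -> F (persp s) = persp (f s).

Lemma perspZ {d : nat} (a : R) (s : 'rV[R]_d.+1) :
  0 < a -> persp (a *: s) = persp s.
Proof.
move=> a0; apply/rowP => i; rewrite !mxE invfM mulrACA mulfV ?mul1r//.
exact: lt0r_neq0.
Qed.

Let lift_row {d : nat} (x : 'rV[R]_d) : 'rV[R]_d.+1 :=
  \row_i (if unlift ord0 i is Some j then x 0 j else 1).

Let lift_rowP {d : nat} (x : 'rV[R]_d) :
  dom_persp (lift_row x) /\ persp (lift_row x) = x.
Proof.
split; first by rewrite /dom_persp/= mxE unlift_none.
by apply/rowP => i; rewrite !mxE unlift_none liftK divr1.
Qed.

Let lift_rowK {d : nat} (s : 'rV[R]_d.+1) : dom_persp s ->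
  s = s 0 ord0 *: lift_row (persp s).
Proof.
rewrite /dom_persp/= => s0; apply/rowP => i; rewrite !mxE.
case: unliftP => [j|] ->; last by rewrite mulr1.
by rewrite mxE mulrC divfK// lt0r_neq0.
Qed.

Lemma induced_map_exists_unique {d d' : nat}
    (f : 'rV[R]_d.+1 -> 'rV[R]_d'.+1) :
  scaling_condition f -> exists! F, induced_map f F.
Proof.
move=> fs; exists (fun x => persp (f (lift_row x))); split.
  move=> s ds; have [dl _] := lift_rowP (persp s).
  have [mu mu0 e] := fs _ dl _ ds.
  by rewrite [in RHS](lift_rowK ds) e perspZ.
move=> F FE; apply/funext => x; have [dl {2}<-] := lift_rowP x.
by rewrite FE.
Qed.

End Perspective.

Section Trajectories.
Context {R : realType}.

(* The component [m] of the terms (S_i, W_i, m) does not depend on i. *)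
Record trajectory (d : nat) (W : Type) := Trajectory {
  price : nat -> 'rV[R]_d.+1 ;
  info : nat -> W ;
  stage : nat }.

Definition term {d : nat} {W : Type} (S : trajectory d W) (i : nat) :=
  (price S i, info S i, stage S).

(* The last clause is the standing positivity assumption on the numeraire. *)
Definition trajectory_set {d : nat} {W : Type}
    (Sigma : nat -> set 'rV[R]_d.+1) (Omega : nat -> set W) (Theta : set nat)
    (s0 : 'rV[R]_d.+1) (w0 : W) (calS : set (trajectory d W)) : Prop :=
  Omega 0%N w0 /\
  forall S, calS S ->
    [/\ forall i, Sigma i (price S i) /\ Omega i (info S i),
        Theta (stage S),
        price S 0%N = s0 /\ info S 0%N = w0
      & forall i, dom_persp (price S i)].

Definition node {d : nat} {W : Type} (calS : set (trajectory d W))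
    (S : trajectory d W) (k : nat) : set (trajectory d W) :=
  [set T | [/\ calS T, forall i, (i <= k)%N -> term T i = term S i
             & (k < stage T)%N]].

(* [N] is the set of trajectories through the node [(S, k)]. *)
Definition zero_neutral_along {d : nat} {W : Type}
    (N : set (trajectory d W)) (S : trajectory d W) (k : nat) : Prop :=
  closure (convex_hull
    [set persp (price T k.+1) - persp (price S k) | T in N]) 0.

Definition zero_neutral {d : nat} {W : Type} (calS : set (trajectory d W))
    (S : trajectory d W) (k : nat) : Prop :=
  zero_neutral_along (node calS S k) S k.

Definition map_trajectory {d d' : nat} {W : Type}
    (f : 'rV[R]_d.+1 -> 'rV[R]_d'.+1) (S : trajectory d W) : trajectory d' W :=
  Trajectory (f \o price S) (info S) (stage S).

(* The trajectories through the transformed node are the transforms of those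
   through [(S, k)]; since [f] need not be injective, these may be fewer than
   the transformed trajectories that agree with [map_trajectory f S] up to k. *)
Definition transformed_zero_neutral {d d' : nat} {W : Type}
    (f : 'rV[R]_d.+1 -> 'rV[R]_d'.+1) (calS : set (trajectory d W))
    (S : trajectory d W) (k : nat) : Prop :=
  zero_neutral_along (map_trajectory f @` node calS S k)
    (map_trajectory f S) k.

Definition zero_neutral_symmetry {d d' : nat}
    (f : 'rV[R]_d.+1 -> 'rV[R]_d'.+1) : Prop :=
  forall (W : Type) (Sigma : nat -> set 'rV[R]_d.+1) (Omega : nat -> set W)
    (Theta : set nat) (s0 : 'rV[R]_d.+1) (w0 : W)
    (calS : set (trajectory d W)),
  trajectory_set Sigma Omega Theta s0 w0 calS ->
  forall (S : trajectory d W) (k : nat), calS S -> zero_neutral calS S k ->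
  closure (convex_hull
    [set persp (f (price T k.+1)) | T in node calS S k]) (persp (f (price S k))).

End Trajectories.

Arguments trajectory R d W : clear implicits.

(* Main.v *)
(** Since F is inversely convexity preserving, the preimage under F of a convex
    set is convex; hence F (co A) is contained in co (F (A)), and continuity of
    F extends this to closures.  Translations are themselves continuous and
    inversely convexity preserving, so the same inclusion, applied to
    x |-> F (x + c) - F c with c = X (S_k), handles the recentering of the
    increments at 0. *)
Require Import Defs.
From mathcomp Require Import interval_inference.

Set Implicit Arguments.
Unset Strict Implicit.
Unset Printing Implicit Defensive.

Import Order.TTheory GRing.Theory Num.Theory.
Import numFieldNormedType.Exports.

Local Open Scope classical_set_scope.
Local Open Scope ring_scope.

Section InverseConvexity.
Context {R : realType}.
Local Notation icp := (inversely_convexity_preserving [set: _]).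

Lemma icp_comp (U V W : lmodType R) (g : U -> V) (h : V -> W) :
  icp g -> icp h -> icp (h \o g).
Proof.
move=> ig ih x y _ _ _ [z xyz <-] /=.
by apply: ih => //; exists (g z) => //; apply: ig => //; exists z.
Qed.

(** The weights [t] and [1 - t] sum to 1, so the same [t] works after the translation. *)
Lemma icp_addr (V : lmodType R) (c : V) : icp (fun x : V => x + c).
Proof.
move=> x y _ _ _ [_ [t t01 <-] <-]; exists t => //.
by rewrite !scalerDr addrACA -scalerDl (addrC t) subrK scale1r.
Qed.

Lemma convex_hull_image (V W : lmodType R) (g : V -> W) (A : set V) :
  icp g -> g @` convex_hull A `<=` convex_hull (g @` A).
Proof.
move=> ig _ [x Ax <-] B [cB AB].
(* The hull lies in every convex superset of [A]; the one chosen is the preimage of an arbitrary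
   convex [B] containing the image of [A]. *)
apply: (Ax (g @^-1` B)); split; last by move=> a Aa; apply: AB; exists a.
move=> y z t /[!inE] By Bz /=.
have : hull_segment (g y) (g z) (g (t%:num *: y + (1 - t%:num) *: z)).
  apply: ig => //; exists (t%:num *: y + (1 - t%:num) *: z) => //.
  by exists t%:num => //=; apply/andP; split; [exact: ge0|exact: le1].
move=> [u /andP[u0 u1] gyz].
(* The weight [u] on the image segment may differ from [t], so convexity of [B] is invoked at
   [u]. *)
have := cB (g y) (g z) (Itv01 u0 u1); rewrite !inE => /(_ By Bz).
by rewrite /preimage/= -gyz.
Qed.

End InverseConvexity.

Lemma closure_image (T U : topologicalType) (g : T -> U) (A : set T) (x : T) :
  {for x, continuous g} -> closure A x -> closure (g @` A) (g x).
Proof.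
move=> gx Ax B /gx/Ax[a [Aa Ba]].
by exists (g a); split => //; exists a.
Qed.

(** A neighbourhood of [M] contains a box of entrywise neighbourhoods [P i j], and a filter is
    stable under the finite intersection over all entries. *)
Lemma cvg_mx (T U : topologicalType) (m n : nat) (G : set_system T)
    (FG : Filter G) (h : T -> 'M[U]_(m, n)) (M : 'M[U]_(m, n)) :
  (forall i j, (fun t => h t i j) @ G --> M i j) -> h @ G --> M.
Proof.
move=> hM A [P MP PA]; rewrite nbhs_filterE /nbhs/=.
apply: filterS (_ : G (fun t => forall i j, P i j (h t i j))).
  by move=> t Pt; exact: PA.
by apply: filter_forall => i; apply: filter_forall => j; exact: hM (MP i j).
Qed.

Section PerspectiveContinuity.
Context {R : realType}.

(** A section of [persp] that normalises the numeraire, coordinate 0, to 1. *)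
Definition unit_lift {d : nat} (x : 'rV[R]_d) : 'rV[R]_d.+1 :=
  \row_i oapp (x 0) 1 (unlift ord0 i).

Lemma unit_lift_dom {d : nat} (x : 'rV[R]_d) : dom_persp (unit_lift x).
Proof. by rewrite /dom_persp/= mxE unlift_none. Qed.

Lemma unit_liftK {d : nat} : cancel (@unit_lift d) persp.
Proof.
by move=> x; apply/rowP => i; rewrite !mxE unlift_none liftK/= divr1.
Qed.

Lemma unit_lift_continuous {d : nat} : continuous (@unit_lift d).
Proof.
move=> x; apply: (cvg_mx (G := nbhs _)) => i j; rewrite [X in _ --> X]mxE.
under eq_fun do rewrite mxE.
case: unliftP => [k|] _ /=; last exact: cvg_cst.
exact: coord_continuous.
Qed.

Lemma dom_persp_open {d : nat} : open (@dom_persp R d).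
Proof.
rewrite (_ : dom_persp =
  (fun s : 'rV[R]_d.+1 => s 0 ord0) @^-1` [set x | 0 < x])//.
by apply: open_comp; [move=> ? _; exact: coord_continuous|exact: open_gt].
Qed.

Lemma persp_continuous {d : nat} (s : 'rV[R]_d.+1) :
  dom_persp s -> {for s, continuous persp}.
Proof.
move=> ds; apply: (cvg_mx (G := nbhs _)) => i j; rewrite [X in _ --> X]mxE.
under eq_fun do rewrite mxE.
apply: cvgM; first exact: coord_continuous.
apply: cvgV; [exact: lt0r_neq0|exact: coord_continuous].
Qed.

(** The section [unit_lift] gives the explicit formula [persp \o f \o unit_lift] for [F], a
    composite of continuous maps. *)
Lemma induced_map_continuous {d d' : nat}
    (f : 'rV[R]_d.+1 -> 'rV[R]_d'.+1) (F : 'rV[R]_d -> 'rV[R]_d') :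
  (forall s, dom_persp s -> dom_persp (f s)) ->
  {within dom_persp, continuous f} -> induced_map f F -> continuous F.
Proof.
move=> f_dom + f_F x.
(* On an open set, relative continuity is ordinary continuity at each of its points, which can be
   composed. *)
rewrite continuous_open_subspace; last exact: dom_persp_open.
move=> f_cont.
rewrite (_ : F = persp \o f \o unit_lift); last first.
  by apply/funext => y /=; rewrite -f_F ?unit_liftK//; exact: unit_lift_dom.
apply: continuous_comp; first exact: unit_lift_continuous.
apply: continuous_comp.
  by apply: f_cont; rewrite inE; exact: unit_lift_dom.
by apply: persp_continuous; apply: f_dom; exact: unit_lift_dom.
Qed.

End PerspectiveContinuity.

Lemma addr_continuous (R : numFieldType) (V : normedModType R) (c : V) :
  continuous (fun x : V => x + c).
Proof.
by move=> x; apply: (continuousD (f := id)); [exact: cvg_id|exact: cvg_cst].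
Qed.

Lemma closure_hull_image (R : realType) (V W : normedModType R) (g : V -> W)
    (A : set V) (x : V) :
  inversely_convexity_preserving [set: V] g -> {for x, continuous g} ->
  closure (convex_hull A) x -> closure (convex_hull (g @` A)) (g x).
Proof.
move=> ig gx /(closure_image gx).
by apply: closureS; exact: convex_hull_image.
Qed.

Theorem theorem5 (R : realType) (d d' : nat) (hd : (1 <= d)%N) (hd' : (1 <= d')%N)
    (f : 'rV[R]_d.+1 -> 'rV[R]_d'.+1) (F : 'rV[R]_d -> 'rV[R]_d')
    (f_dom : forall s, dom_persp s -> dom_persp (f s))
    (f_cont : {within dom_persp, continuous f})
    (f_scale : scaling_condition f)
    (f_F : induced_map f F)
    (F_icp : inversely_convexity_preserving [set: 'rV[R]_d] F) :
  (forall (W : Type) (Sigma : nat -> set 'rV[R]_d.+1) (Omega : nat -> set W)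
     (Theta : set nat) (s0 : 'rV[R]_d.+1) (w0 : W)
     (calS : set (trajectory R d W)),
   trajectory_set Sigma Omega Theta s0 w0 calS ->
   forall (S : trajectory R d W) (k : nat), calS S ->
   zero_neutral calS S k ->
   transformed_zero_neutral f calS S k /\
   closure (convex_hull
       [set persp (f (price T k.+1)) | T in node calS S k])
     (persp (f (price S k)))) /\
  zero_neutral_symmetry f.
Proof.
have F_cont : continuous F by exact: induced_map_continuous f_F.
suff H (W : Type) (Sigma : nat -> set 'rV[R]_d.+1) (Omega : nat -> set W)
    (Theta : set nat) (s0 : 'rV[R]_d.+1) (w0 : W)
    (calS : set (trajectory R d W)) :
  trajectory_set Sigma Omega Theta s0 w0 calS ->
  forall (S : trajectory R d W) (k : nat), calS S ->
  zero_neutral calS S k ->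
  transformed_zero_neutral f calS S k /\
  closure (convex_hull
      [set persp (f (price T k.+1)) | T in node calS S k])
    (persp (f (price S k))).
  split=> [|W Sg Om Th s0 w0 cS tS S k SS SN]; first exact: H.
  by have [] := H _ _ _ _ _ _ _ tS _ _ SS SN.
move=> [_ domS] S k SS SN.
have domp T i : calS T -> dom_persp (price T i) by move=> /domS[].
set c := persp (price S k).
have FcE : F c = persp (f (price S k)) by apply: f_F; exact: domp.
have Fc_cont : continuous (F \o (fun x : 'rV[R]_d => x + c)).
  move=> x; apply: continuous_comp; last exact: F_cont.
  exact: addr_continuous.
have G_cont :
  continuous ((fun y : 'rV[R]_d' => y - F c) \o (F \o (fun x => x + c))).
  move=> x; apply: continuous_comp; first exact: Fc_cont.
  exact: addr_continuous.
have Fc_icp := icp_comp (@icp_addr R _ c) F_icp.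
split.
(* The recentred map fixes 0 and sends each increment at the node to the increment of the
   transformed prices. *)
- have G_icp := icp_comp Fc_icp (@icp_addr R _ (- F c)).
  have := closure_hull_image G_icp (G_cont _) SN.
  rewrite /= add0r subrr /transformed_zero_neutral /zero_neutral_along.
  (* The rewriting is restricted to [T] in the node, since [f_F] applies only to prices in
     [dom_persp]. *)
  rewrite !image_comp; under eq_imagel => T [/domp dT _ _].
    rewrite /= subrK f_F// FcE; over.
  by [].
(* Without the final translation by [- F c], the point 0 goes to [F c], which yields the uncentred
   form. *)
- have := closure_hull_image Fc_icp (Fc_cont _) SN.
  rewrite /= add0r FcE image_comp; under eq_imagel => T [/domp dT _ _].
    rewrite /= subrK f_F//; over.
  by [].
Qed.
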